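(* Let $M\ge 2$ and suppose that $\boldsymbol{h}\in\mathbb{R}^{d_h^M}$ has a tensor train representation with ranks $(r_1,\dots,r_{M+1})$, $r_1=r_{M+1}=1$. Then the operator $$\boldsymbol{W}=\boldsymbol{P}\boldsymbol{P}^\intercal+\sum_{m=1}^M\boldsymbol{B}_m^\intercal\boldsymbol{B}_m\in\mathbb{R}^{d_a^M\times d_a^M}$$ has a tensor train (operator) representation with ranks $2(r_j+1)^2+1$ for $j=2,\dots,M$, and the right-hand side $$\boldsymbol{b}=\sum_{m=1}^M\boldsymbol{B}_m^\intercal\boldsymbol{f}_m\in\mathbb{R}^{d_a^M}$$ has a tensor train representation with ranks $2r_j(r_j+1)$ for $j=2,\dots,M$. In particular, these ranks are independent of the dimension $M$.
   Context: Write $[n]=\{0,\dots,n-1\}$. Let $\rho$ be the standard Gaussian density on $\mathbb{R}$, let $\{p_j\}_{j\ge0}$ be an orthonormal basis of $L^2(\mathbb{R},\rho)$ of polynomials with $\deg p_j=j$, let $\varrho(y)=\prod_{m=1}^M\rho(y_m)$ and $P_\mu(y)=\prod_{m=1}^M p_{\mu_m}(y_m)$ for $\mu\in\mathbb{N}_0^M$. Let $h(y)=\sum_{\mu\in[d_h]^M}\boldsymbol{h}[\mu]P_\mu(y)$, $y_0=0\in\mathbb{R}^M$, and let $d_a,d_t,d_h\in\mathbb{N}$ with $d_t\ge d_a+d_h-1$. For $m=1,\dots,M$, $\mu\in[d_t]^M$ and $\nu\in[d_a]^M$, define $$\boldsymbol{B}_m[\mu,\nu]=(\partial_mP_\nu-P_\nu\,\partial_mh,\;P_\mu)_{L^2(\mathbb{R}^M,\varrho)},\qquad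 \boldsymbol{f}_m[\mu]=(\exp(h(y_0))\,\partial_mh,\;P_\mu)_{L^2(\mathbb{R}^M,\varrho)},$$ and $\boldsymbol{P}[\nu]=P_\nu(y_0)$ for $\nu\in[d_a]^M$. In the formulas for $\boldsymbol{W}$ and $\boldsymbol{b}$, $\boldsymbol{B}_m$ is regarded as a $d_t^M\times d_a^M$ matrix and $\boldsymbol{f}_m,\boldsymbol{P}$ as vectors. A tensor $\boldsymbol{w}\in\mathbb{R}^{d^M}$ has a tensor train (TT) representation with ranks $(r_1,\dots,r_{M+1})$, $r_1=r_{M+1}=1$, if there are order-three tensors $\boldsymbol{w}_m\in\mathbb{R}^{r_m\times d\times r_{m+1}}$ with $\boldsymbol{w}[\mu]=\sum_{k}\prod_{m=1}^M\boldsymbol{w}_m[k_m,\mu_m,k_{m+1}]$ for all $\mu\in[d]^M$, the sum running over all $k=(k_1,\dots,k_{M+1})$ with $1\le k_m\le r_m$. A linear operator $\boldsymbol{W}\in\mathbb{R}^{d^M\times q^M}$ has a TT representation with such ranks if there are order-four tensors $\boldsymbol{W}_m\in\mathbb{R}^{r_m\times d\times q\times r_{m+1}}$ with $\boldsymbol{W}[\mu,\nu]=\sum_k\prod_{m=1}^M\boldsymbol{W}_m[k_m,\mu_m,\nu_m,k_{m+1}]$ for all $\mu\in[d]^M$, $\nu\in[q]^M$. The first and last ranks of the representations of $\boldsymbol{W}$ and $\boldsymbol{b}$ are $1$. *)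

(* Defs.v *)
From HB Require Import structures.
From mathcomp Require Export all_boot all_order all_algebra.
From mathcomp Require Export all_classical all_reals all_analysis.
Set Implicit Arguments.
Unset Strict Implicit.
Unset Printing Implicit Defensive.
Import Order.TTheory GRing.Theory Num.Theory.
Import numFieldNormedType.Exports.
Local Open Scope classical_set_scope.
Local Open Scope ring_scope.

(* Lebesgue measure on R^n, carried by [n.-tuple (measurableTypeR R)] and built
   by iterating the product with the one-dimensional Lebesgue measure. *)
Section lebesgue_tuple.
Context {R : realType}.
Local Notation RT := (measurableTypeR R).

Definition cons_pair n (z : RT * n.-tuple RT) : n.+1.-tuple RT :=
  [tuple of z.1 :: z.2].

Definition uncons_pair n (t : n.+1.-tuple RT) : RT * n.-tuple RT :=
  (thead t, [tuple of behead t]).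

Lemma cons_pairK n : cancel (@cons_pair n) (@uncons_pair n).
Proof.
by case=> x t; rewrite /uncons_pair theadE; congr pair; apply/val_inj.
Qed.

Lemma measurable_cons_pair n : measurable_fun setT (@cons_pair n).
Proof.
by apply: measurable_cons; [exact: measurable_fst|exact: measurable_snd].
Qed.

Lemma measurable_uncons_pair n : measurable_fun setT (@uncons_pair n).
Proof.
apply/measurable_fun_pairP; split; first exact: measurable_tnth.
exact: measurable_behead.
Qed.

Section step.
Context n (mu : {sigma_finite_measure set (n.-tuple RT) -> \bar R}).

Definition lebesgue_cons : set (n.+1.-tuple RT) -> \bar R :=
  pushforward (lebesgue_measure \x mu)%E (@cons_pair n).

Let nu : {measure set (n.+1.-tuple RT) -> \bar R} :=
  @measure_function_pushforward__canonical__measure_function_Measure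
    _ _ _ _ R (lebesgue_measure \x mu)%E _ (@measurable_cons_pair n).

HB.instance Definition _ := isMeasure.Build _ _ _ lebesgue_cons
  (measure0 nu) (measure_ge0 nu) (@measure_semi_sigma_additive _ _ _ nu).

Let lebesgue_cons_sigma_finite : sigma_finite setT lebesgue_cons.
Proof.
pose leb : {sigma_finite_measure set RT -> \bar R} := lebesgue_measure.
have /sigma_finiteP[F [FT ndF Foo]] := sigma_finiteT leb.
have /sigma_finiteP[G [GT ndG Goo]] := sigma_finiteT mu.
exists (fun i => @uncons_pair n @^-1` (F i `*` G i)).
  apply/esym; rewrite -subTset => t _.
  have [i _ Fi] : (\bigcup_i F i) (thead t) by rewrite -FT.
  have [j _ Gj] : (\bigcup_i G i) [tuple of behead t] by rewrite -GT.
  exists (maxn i j) => //; split => /=.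
    by move: Fi; exact/subsetPset/ndF/leq_maxl.
  by move: Gj; exact/subsetPset/ndG/leq_maxr.
move=> i; have [mF Fi] := Foo i; have [mG Gi] := Goo i; split.
  rewrite -[X in measurable X]setTI; apply: measurable_uncons_pair => //.
  exact: measurableX.
rewrite /lebesgue_cons /pushforward -comp_preimage.
have -> : @uncons_pair n \o @cons_pair n = id.
  by apply/funext => z /=; rewrite cons_pairK.
rewrite preimage_id product_measure1E// lte_mul_pinfty//.
by rewrite ge0_fin_numE.
Qed.

HB.instance Definition _ := Measure_isSigmaFinite.Build _ _ _ lebesgue_cons
  lebesgue_cons_sigma_finite.

End step.

Fixpoint lebesgue_tuple n : {sigma_finite_measure set (n.-tuple RT) -> \bar R} :=
  match n with
  | 0 => dirac ([tuple] : 0.-tuple RT)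
  | n'.+1 => lebesgue_cons (lebesgue_tuple n')
  end.
End lebesgue_tuple.

Section gaussian.
Context {R : realType}.
Local Notation leb := (@lebesgue_measure R).

Definition rho : R -> R := normal_pdf 0 1.

Definition orthonormal_poly_basis (p : nat -> {poly R}) : Prop :=
  let c (f : R -> R) j := \int[leb]_x (f x * (p j).[x] * rho x) in
  [/\ forall j, size (p j) = j.+1,
      forall i j, \int[leb]_x ((p i).[x] * (p j).[x] * rho x) = (i == j)%:R
    & forall f : R -> R, measurable_fun setT f ->
        (\int[leb]_x (f x ^+ 2 * rho x)%:E < +oo)%E ->
        (fun n => \int[leb]_x
           ((f x - \sum_(j < n) c f j * (p j).[x]) ^+ 2 * rho x)%:E)%E
          @ \oo --> 0%E].

(* Points of R^M are row vectors (a normed space, for derivatives); integrals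
   over R^M are taken through the coordinates, on tuples. *)
Definition point_of_tuple M (t : M.-tuple (measurableTypeR R)) : 'rV[R]_M :=
  \row_m tnth t m.

Definition varrho M (y : 'rV[R]_M) : R := \prod_(m < M) rho (y 0 m).

Definition innerL2 M (f g : 'rV[R]_M -> R) : R :=
  \int[lebesgue_tuple M]_t
    (let y := point_of_tuple t in f y * g y * varrho y).

Definition partial M (m : 'I_M) (f : 'rV[R]_M -> R) (y : 'rV[R]_M) : R :=
  'D_(delta_mx 0 m) f y.

End gaussian.

Definition midx (M d : nat) := {ffun 'I_M -> 'I_d}.

Definition tensor (R : Type) (M d : nat) := midx M d -> R.

Definition operator (R : Type) (M d q : nat) := midx M d -> midx M q -> R.

(* The ranks are indexed from 0: [r j] is the mathematical r_(j+1), and the m-th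
   core sits between the positions [widen_ord _ m] (value m) and [lift ord0 m]
   (value m + 1). *)
Section tensor_train.
Context {R : realType} {M : nat}.
Implicit Types (r : 'I_M.+1 -> nat).

Definition lpos (m : 'I_M) : 'I_M.+1 := widen_ord (leqnSn M) m.
Definition rpos (m : 'I_M) : 'I_M.+1 := lift ord0 m.

Definition has_tt r d (w : tensor R M d) : Prop :=
  [/\ r ord0 = 1%N, r ord_max = 1%N &
  exists core : forall m : 'I_M, 'I_(r (lpos m)) -> 'I_d -> 'I_(r (rpos m)) -> R,
  forall mu : midx M d,
    w mu = \sum_(k : {dffun forall j : 'I_M.+1, 'I_(r j)})
             \prod_(m < M) core m (k (lpos m)) (mu m) (k (rpos m))].

Definition has_tt_op r d q (W : operator R M d q) : Prop :=
  [/\ r ord0 = 1%N, r ord_max = 1%N &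
  exists core : forall m : 'I_M,
    'I_(r (lpos m)) -> 'I_d -> 'I_q -> 'I_(r (rpos m)) -> R,
  forall (mu : midx M d) (nu : midx M q),
    W mu nu = \sum_(k : {dffun forall j : 'I_M.+1, 'I_(r j)})
                \prod_(m < M) core m (k (lpos m)) (mu m) (nu m) (k (rpos m))].

Definition inner_ranks (s : nat -> nat) r : 'I_M.+1 -> nat :=
  fun j => if (j == ord0) || (j == ord_max) then 1%N else s (r j).

End tensor_train.

Section system.
Context {R : realType} {M : nat} (p : nat -> {poly R}).

Definition Pprod d (mu : midx M d) (y : 'rV[R]_M) : R :=
  \prod_(m < M) (p (mu m)).[y 0 m].

Definition expansion d (w : tensor R M d) (y : 'rV[R]_M) : R :=
  \sum_(mu : midx M d) w mu * Pprod mu y.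

Variables (da dt dh : nat) (hh : tensor R M dh).
Let h := expansion hh.

Definition Bop (m : 'I_M) : operator R M dt da := fun mu nu =>
  innerL2 (fun y => partial m (Pprod nu) y - Pprod nu y * partial m h y)
    (Pprod mu).

Definition fvec (m : 'I_M) : tensor R M dt := fun mu =>
  innerL2 (fun y => expR (h 0) * partial m h y) (Pprod mu).

Definition Pvec : tensor R M da := fun nu => Pprod nu 0.

Definition Wop : operator R M da da := fun mu nu =>
  Pvec mu * Pvec nu
  + \sum_(m < M) \sum_(ka : midx M dt) Bop m ka mu * Bop m ka nu.

Definition bvec : tensor R M da := fun nu =>
  \sum_(m < M) \sum_(ka : midx M dt) Bop m ka nu * fvec m ka.

End system.
Arguments Wop {R M} p da dt {dh} hh.
Arguments bvec {R M} p da dt {dh} hh.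

(* Main.v *)
Require Import Defs.
From mathcomp Require Import measurable_realfun ring lra.
Set Implicit Arguments.
Unset Strict Implicit.
Unset Printing Implicit Defensive.
Import Order.TTheory GRing.Theory Num.Theory.
Import numFieldNormedType.Exports.
Local Open Scope classical_set_scope.
Local Open Scope ring_scope.

(** The idea is to write everything as a sum over paths
    [k : 'I_M.+1 -> T] of products of cores, in which case sums, products and
    contractions of such expressions act on the state space [T] alone.

    Every integrand is a sum of products of one-variable polynomials times the
    product Gaussian density, so by Fubini ([lebesgue_tuple_prod]) every inner
    product factorizes over the coordinates into the one-dimensional means
    [gauss_mean] ([Bop_gauss_mean], [fvec_gauss_mean]).  In the
    m-th partial derivative of a product of one-variable polynomials only the
    m-th factor is differentiated.  Inserting the tensor train of [h] then shows
    the following.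

    - [Bop m] is the difference of a rank one product and of a path sum over the
      states of [h]: this is a path sum over [option T], hence of rank
      [r_j + 1] ([Bop_path_sum], by [path_sum_option]).
    - [fvec m] is a path sum over [T], hence of rank [r_j] ([fvec_path_sum]).
    - In the entries of [Bop m ^T Bop m] and [Bop m ^T fvec m] the states are
      paired ([path_sum_pair]) and the contracted index is summed inside each
      core ([sum_path_sum]): the ranks are [(r_j + 1) ^ 2] and
      [(r_j + 1) * r_j].
    - The m-th of these path sums has one kind of core at position m and another
      kind, the same for all m, at the other positions.  The sum over m is
      therefore a single path sum whose states carry one extra bit, telling
      whether the marked position has been passed ([path_sum_step]).  This is
      what keeps the ranks independent of the dimension: they only double.
    - The rank one operator given by [Pvec] adds one more state
      ([path_sum_option]).

    These path sums have weights on their two end states instead of one-element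
    end state spaces; the weights are absorbed in the first and last cores
    ([path_sum_start], [path_sum_end]), and the states that a path can visit at
    a given position are enumerated to get the cores of a tensor train
    ([path_sum_tt]). *)

(** * Sums over paths *)

Section path_sums.
Context {R : comNzRingType} {M : nat}.

Lemma sum_codom (I J : finType) (f : J -> I) (F : I -> R) : injective f ->
  (forall i, i \notin codom f -> F i = 0) -> \sum_i F i = \sum_j F (f j).
Proof.
move=> f_inj F0; rewrite (bigID (mem (codom f)))/= [X in _ + X]big1 // addr0.
rewrite -(big_imset F (A := J) (in2W f_inj))/=; apply: eq_bigl => i.
by apply/codomP/imsetP => [[j ->]|[j _ ->]]; exists j.
Qed.

(** All positions share the state space [T]; position-dependent ranks are
    recovered from cores that vanish outside a set of states.  The weights [a]
    and [b] stand for the boundary vectors of a product of matrices. *)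
Definition path_sum (T : finType) (a b : T -> R) (c : 'I_M -> T -> T -> R) : R :=
  \sum_(k : {ffun 'I_M.+1 -> T})
    a (k ord0) * (\prod_(m < M) c m (k (lpos m)) (k (rpos m))) * b (k ord_max).

Lemma eq_path_sum (T : finType) (a b : T -> R) c c' :
  (forall m x y, c m x y = c' m x y) -> path_sum a b c = path_sum a b c'.
Proof.
by move=> cc; apply: eq_bigr => k _; congr (_ * _ * _); apply: eq_bigr.
Qed.

Lemma rposP (j : 'I_M.+1) : j != ord0 -> exists m, j = rpos m.
Proof. by rewrite eq_sym => /unlift_some[m ->]; exists m. Qed.

Lemma mono_pos (g : 'I_M.+1 -> bool) :
  (forall m, g (lpos m) -> g (rpos m)) ->
  forall i j : 'I_M.+1, (i <= j)%N -> g i -> g j.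
Proof.
move=> gS i; suff H n (j : 'I_M.+1) : j = (i + n)%N :> nat -> g i -> g j.
  by move=> j ij; apply: (H (j - i)%N); rewrite subnKC.
elim: n j => [|n IHn] j; first by rewrite addn0 => /val_inj ->.
rewrite addnS => jE gi; have jM : (i + n < M)%N by rewrite -ltnS -jE.
suff -> : j = rpos (Ordinal jM) by apply/gS/IHn.
by apply/val_inj; rewrite /= jE.
Qed.

Lemma const_pos (g : 'I_M.+1 -> bool) :
  (forall m, g (lpos m) = g (rpos m)) -> forall j, g j = g ord0.
Proof.
move=> gE j; apply/idP/idP; last by apply: mono_pos => // m; rewrite gE.
apply: contraLR; apply: (@mono_pos (fun i => ~~ g i)) => // m.
by rewrite gE.
Qed.

(** The direct sum of a rank one product, carried by the state [None], and of the
    cores [c]. *)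
Definition option_core (T : Type) (c0 : 'I_M -> R) (c : 'I_M -> T -> T -> R)
    (m : 'I_M) (x y : option T) : R :=
  match x, y with
  | None, None => c0 m
  | Some x, Some y => c m x y
  | _, _ => 0
  end.

(** A path contributes only if it never switches between [None] and [Some], so
    that it is either constantly [None] or a path in [T]. *)
Lemma path_sum_option (T : finType) a0 (a : T -> R) b0 (b : T -> R) c0 c :
  path_sum (oapp a a0) (oapp b b0) (option_core c0 c) =
  a0 * (\prod_(m < M) c0 m) * b0 + path_sum a b c.
Proof.
rewrite /path_sum (bigD1 [ffun=> None])//= !ffunE/=; congr (_ * _ * _ + _).
  by apply: eq_bigr => m _; rewrite !ffunE.
rewrite big_mkcond/=.
pose f (k : {ffun 'I_M.+1 -> T}) : {ffun 'I_M.+1 -> option T} :=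
  [ffun j => Some (k j)].
rewrite (@sum_codom _ _ f) => [|k k' /ffunP kk|k kf]; last 2 first.
- by apply/ffunP => j; have := kk j; rewrite !ffunE => -[].
- case: ifP => // /eqP kN.
  have [/forallP/= kE|/forallPn/=[m km]] :=
    boolP [forall m, isSome (k (lpos m)) == isSome (k (rpos m))]; last first.
    rewrite (bigD1 m)//=; move: km.
    by case: (k (lpos m)) => [x|]; case: (k (rpos m)) => [y|]//=;
      rewrite mul0r mulr0 mul0r.
  have {kE} := @const_pos (fun j => isSome (k j)) (fun m => eqP (kE m)).
  case k0 : (k ord0) => [t|] kE; last first.
    by case: kN; apply/ffunP => j; rewrite ffunE; have := kE j; case: (k j).
  case/codomP: kf; exists [ffun j => odflt t (k j)]; apply/ffunP => j.
  by rewrite !ffunE; have := kE j; case: (k j).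
- apply: eq_bigr => k _.
  case: eqP => [/ffunP/(_ ord0)|_]; first by rewrite !ffunE.
  rewrite !ffunE/=; congr (_ * _ * _).
  by apply: eq_bigr => m _; rewrite !ffunE.
Qed.

Definition pair_core (T T' : Type) (c : 'I_M -> T -> T -> R)
    (c' : 'I_M -> T' -> T' -> R) (m : 'I_M) (x y : T * T') : R :=
  c m x.1 y.1 * c' m x.2 y.2.

Lemma path_sum_pair (T T' : finType) (a b : T -> R) (a' b' : T' -> R) c c' :
  path_sum (fun x => a x.1 * a' x.2) (fun x => b x.1 * b' x.2)
    (pair_core c c') = path_sum a b c * path_sum a' b' c'.
Proof.
rewrite /path_sum big_distrlr pair_bigA/=.
pose f (k : {ffun 'I_M.+1 -> T} * {ffun 'I_M.+1 -> T'}) :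
  {ffun 'I_M.+1 -> T * T'} := [ffun j => (k.1 j, k.2 j)].
rewrite (@sum_codom _ _ f) => [|[k l] [k' l'] /ffunP kk|k kf].
- apply: eq_bigr => k _; rewrite !ffunE/=.
  rewrite (eq_bigr (fun m => c m (k.1 (lpos m)) (k.1 (rpos m)) *
    c' m (k.2 (lpos m)) (k.2 (rpos m)))) => [|m _]; last by rewrite !ffunE.
  by rewrite big_split/= (mulrACA (a _)) [LHS]mulrACA.
- by congr pair; apply/ffunP => j; have := kk j; rewrite !ffunE => -[].
- case/codomP: kf; exists ([ffun j => (k j).1], [ffun j => (k j).2]).
  by apply/ffunP => j; rewrite !ffunE; case: (k j).
Qed.

(** The block matrices [[c, c'], [0, c]]: the bit may switch once from [false]
    to [true], and [c'] is used at the switch. *)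
Definition step_core (T : Type) (c c' : 'I_M -> T -> T -> R)
    (m : 'I_M) (x y : bool * T) : R :=
  match x.1, y.1 with
  | false, true => c' m x.2 y.2
  | true, false => 0
  | _, _ => c m x.2 y.2
  end.

(** A path contributes only if its bit is nondecreasing, [false] at the start and
    [true] at the end; such paths correspond to the position m of the switch
    together with a path in [T]. *)
Lemma path_sum_step (T : finType) (a b : T -> R) c c' :
  path_sum (fun x => if x.1 then 0 else a x.2)
           (fun x => if x.1 then b x.2 else 0) (step_core c c') =
  \sum_(m < M) path_sum a b (fun l => if l == m then c' l else c l).
Proof.
rewrite /path_sum pair_bigA/=.
pose f (mk : 'I_M * {ffun 'I_M.+1 -> T}) : {ffun 'I_M.+1 -> bool * T} :=
  [ffun j : 'I_M.+1 => ((mk.1 < j)%N, mk.2 j)].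
rewrite (@sum_codom _ _ f) => [|[m k] [m' k'] /ffunP kk|k kf].
- apply: eq_bigr => -[m k] _; rewrite !ffunE/= ltn_ord; congr (_ * _ * _).
  apply: eq_bigr => l _; rewrite !ffunE/= /step_core/= /bump/= add1n ltnS.
  by rewrite -(inj_eq val_inj)/=; case: ltngtP.
- congr pair; last by apply/ffunP => j; have := kk j; rewrite !ffunE => -[].
  have := kk (rpos m); have := kk (rpos m'); rewrite !ffunE/= /bump/= !add1n.
  rewrite !ltnS !leqnn => -[m'm _] [mm' _]; apply/val_inj/eqP.
  by rewrite eqn_leq -mm' m'm.
- case k0 : (k ord0).1; first by rewrite !mul0r.
  case kM : (k ord_max).1; last by rewrite mulr0.
  have [/forallP/= kS|/forallPn/=[m]] :=
    boolP [forall m, (k (lpos m)).1 ==> (k (rpos m)).1]; last first.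
    rewrite negb_imply => /andP[km km']; rewrite (bigD1 m)//= /step_core km.
    by rewrite (negbTE km') mul0r mulr0 mul0r.
  have {kS}kS := @mono_pos (fun j => (k j).1) (fun m => implyP (kS m)).
  have [/forallP/= kE|/forallPn/=[m km]] :=
    boolP [forall m, (k (lpos m)).1 == (k (rpos m)).1].
    have := @const_pos (fun j => (k j).1) (fun m => eqP (kE m)) ord_max.
    by rewrite k0 kM.
  have ml : (k (lpos m)).1 = false.
    apply/negP => kl; move: km; rewrite kl (kS (lpos m) (rpos m))//=.
  have mr : (k (rpos m)).1 by move: km; rewrite ml; case: (k _).1.
  case/codomP: kf; exists (m, [ffun j => (k j).2]); apply/ffunP => j.
  rewrite !ffunE/=; case: ltnP => mj.
    by have := kS (rpos m) j; rewrite /= /bump/= add1n => /(_ mj mr);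
      case: (k j) => /= [] [].
  have := kS j (lpos m) mj; case: (k j) => /= -[]//= t /(_ isT).
  by rewrite ml.
Qed.

(** Once the path is fixed, the summand is a product of functions of the separate
    indices [ka m]. *)
Lemma sum_path_sum (I T : finType) (a b : T -> R) (c : 'I_M -> I -> T -> T -> R) :
  \sum_(ka : {ffun 'I_M -> I}) path_sum a b (fun m => c m (ka m)) =
  path_sum a b (fun m x y => \sum_i c m i x y).
Proof.
rewrite exchange_big/=; apply: eq_bigr => k _.
by rewrite -mulr_suml -mulr_sumr bigA_distr_bigA.
Qed.

(** The paths are grouped by their values off [j]; the representative of a group
    takes the value [t0] at [j]. *)
Lemma sum_update (T : finType) (F : {ffun 'I_M.+1 -> T} -> R) j t0 :
  \sum_k F k = \sum_(k : {ffun 'I_M.+1 -> T} | k j == t0)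
    \sum_u F [ffun i => if i == j then u else k i].
Proof.
pose upd (k : {ffun 'I_M.+1 -> T}) u := [ffun i => if i == j then u else k i].
rewrite (partition_big (fun k => upd k t0) (fun k => k j == t0))/=; last first.
  by move=> k _; rewrite ffunE eqxx.
apply: eq_bigr => k /eqP kj.
rewrite (reindex_onto (upd k) (fun k' => k' j))/=; last first.
  move=> k' /eqP <-; apply/ffunP => i; rewrite !ffunE; case: eqP => //= -> //.
apply: eq_bigl => u; rewrite /upd [X in _ && (X == _)]ffunE !eqxx andbT.
apply/eqP/ffunP => i.
by rewrite !ffunE; case: eqP => [->|].
Qed.

(** Only the first core is changed: it no longer depends on its left state, the
    weight of which has been summed. *)
Definition start_core (T : finType) (a : T -> R) (c : 'I_M -> T -> T -> R)
    (m : 'I_M) (x y : T) : R :=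
  if m == 0%N :> nat then \sum_u a u * c m u y else c m x y.

Definition end_core (T : finType) (b : T -> R) (c : 'I_M -> T -> T -> R)
    (m : 'I_M) (x y : T) : R :=
  if m.+1 == M then \sum_u c m x u * b u else c m x y.

Lemma path_sum_start (T : finType) (a b : T -> R) c (t0 : T) : (0 < M)%N ->
  path_sum a b c = path_sum (fun x => (x == t0)%:R) b (start_core a c).
Proof.
move=> M0; rewrite /path_sum (sum_update _ ord0 t0).
rewrite [RHS](bigID (fun k : {ffun _ -> T} => k ord0 == t0))/=.
rewrite [X in _ + X]big1 ?addr0 => [|k /negbTE->]; last by rewrite !mul0r.
apply: eq_bigr => k ->; rewrite mul1r.
rewrite (bigD1 (Ordinal M0))//= {1}/start_core/= !mulr_suml.
apply: eq_bigr => u _; rewrite !ffunE/= (bigD1 (Ordinal M0))//= !ffunE/=.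
have -> : (ord_max : 'I_M.+1) == ord0 = false.
  by rewrite -(inj_eq val_inj)/= gtn_eqF.
rewrite -!mulrA; congr (_ * (_ * (_ * _))).
apply: eq_bigr => m; rewrite -(inj_eq val_inj)/= => m0.
by rewrite !ffunE -(inj_eq val_inj)/= /start_core (negbTE m0).
Qed.

Lemma path_sum_end (T : finType) (a b : T -> R) c (t0 : T) : (0 < M)%N ->
  path_sum a b c = path_sum a (fun x => (x == t0)%:R) (end_core b c).
Proof.
move=> M0; rewrite /path_sum (sum_update _ ord_max t0).
rewrite [RHS](bigID (fun k : {ffun _ -> T} => k ord_max == t0))/=.
rewrite [X in _ + X]big1 ?addr0 => [|k /negbTE->]; last by rewrite !mulr0.
apply: eq_bigr => k ->; rewrite mulr1.
have M1 : (M.-1 < M)%N by rewrite prednK.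
rewrite [in RHS](bigD1 (Ordinal M1))//= {1}/end_core/= prednK// eqxx.
rewrite mulr_suml mulr_sumr.
apply: eq_bigr => u _; rewrite !ffunE/= eqxx (bigD1 (Ordinal M1))//= !ffunE/=.
have -> : (ord0 : 'I_M.+1) == ord_max = false.
  by rewrite -(inj_eq val_inj)/= ltn_eqF.
have -> : lpos (Ordinal M1) == ord_max = false.
  by rewrite -(inj_eq val_inj)/= ltn_eqF.
have -> : rpos (Ordinal M1) == ord_max.
  by rewrite -(inj_eq val_inj)/= /bump/= add1n prednK.
rewrite -!mulrA [X in _ * (_ * X)]mulrC; congr (_ * (_ * (_ * _))).
apply: eq_bigr => m; rewrite -(inj_eq val_inj)/= => mM.
have mM' : m.+1 == M = false.
  by apply: contraNF mM => /eqP mE; apply/eqP; have := congr1 predn mE.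
rewrite !ffunE -!(inj_eq val_inj)/= /bump/= add1n /end_core mM'.
by rewrite ltn_eqF.
Qed.

(** If the paths leaving the images of the [e j] contribute nothing, the sum can
    be taken over the dependent paths that index a tensor train. *)
Lemma path_sum_embed (T : finType) (a b : T -> R) (c : 'I_M -> T -> T -> R)
    (r : 'I_M.+1 -> nat) (e : forall j, 'I_(r j) -> T) :
  (forall j, injective (e j)) ->
  (forall k : {ffun 'I_M.+1 -> T},
     (exists j, k j \notin codom (e j)) ->
     a (k ord0) * (\prod_(m < M) c m (k (lpos m)) (k (rpos m))) * b (k ord_max)
     = 0) ->
  path_sum a b c = \sum_(k : {dffun forall j : 'I_M.+1, 'I_(r j)})
    a (e _ (k ord0)) *
    (\prod_(m < M) c m (e _ (k (lpos m))) (e _ (k (rpos m)))) *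
    b (e _ (k ord_max)).
Proof.
move=> e_inj supp; rewrite /path_sum.
pose f (k : {dffun forall j : 'I_M.+1, 'I_(r j)}) : {ffun 'I_M.+1 -> T} :=
  [ffun j => e j (k j)].
rewrite (@sum_codom _ _ f) => [|k k' /ffunP kk|k kf].
- apply: eq_bigr => k _; rewrite !ffunE; congr (_ * _ * _).
  by apply: eq_bigr => m _; rewrite !ffunE.
- by apply/ffunP => j; apply: (e_inj j); have := kk j; rewrite !ffunE.
- apply: supp; have [/forallP/= kE|/forallPn//] :=
    boolP [forall j, k j \in codom (e j)].
  case/codomP: kf; exists (finfun (fun j => iinv (kE j))).
  by apply/ffunP => j; rewrite !ffunE f_iinv.
Qed.

(** A path sum yields tensor train cores as soon as the set [S j] of states that
    matter at each inner position j has the required number of elements.  It is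
    enough that a core vanishes when its right state is outside: every position
    but the first is the right end of a core, and the ends are restricted to
    [t0] once the weights are absorbed.  The type [D] is the index set of a core
    and covers tensors and operators at the same time. *)
Lemma path_sum_tt (D : Type) (T : finType) (t0 : T) (a b : T -> R)
    (c : 'I_M -> D -> T -> T -> R) (S : 'I_M.+1 -> pred T)
    (r : 'I_M.+1 -> nat) :
  (0 < M)%N -> r ord0 = 1%N -> r ord_max = 1%N ->
  (forall j, j != ord0 -> j != ord_max -> #|S j| = r j) ->
  (forall m i x y, y \notin S (rpos m) -> c m i x y = 0) ->
  exists core : forall m, 'I_(r (lpos m)) -> D -> 'I_(r (rpos m)) -> R,
  forall mu : 'I_M -> D,
    path_sum a b (fun m => c m (mu m)) =
    \sum_(k : {dffun forall j : 'I_M.+1, 'I_(r j)})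
      \prod_(m < M) core m (k (lpos m)) (mu m) (k (rpos m)).
Proof.
move=> M0 r0 rM rS cS.
pose S' (j : 'I_M.+1) : pred T :=
  if (j == ord0) || (j == ord_max) then (pred1 t0 : pred T) else S j.
have rS' j : r j = #|S' j|.
  rewrite /S'; have [->|j0]/= := eqVneq j ord0; first by rewrite card1.
  by have [->|jM]/= := eqVneq j ord_max; rewrite ?card1 ?rS.
pose e j (x : 'I_(r j)) : T := enum_val (cast_ord (rS' j) x).
have e_inj j : injective (e j).
  by move=> x y /enum_val_inj /cast_ord_inj.
have eP j t : (t \in codom (e j)) = (t \in S' j).
  apply/codomP/idP => [[x ->]|tS]; first exact: enum_valP.
  exists (cast_ord (esym (rS' j)) (enum_rank_in tS t)).
  by rewrite /e cast_ordKV enum_rankK_in.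
have e0 j x : (j == ord0) || (j == ord_max) -> e j x = t0.
  move=> jE; have : e j x \in S' j by rewrite -eP codom_f.
  by rewrite /S' jE => /eqP.
pose c' m i := end_core b (start_core a (fun m => c m i)) m.
exists (fun m x i y => c' m i (e _ x) (e _ y)) => mu.
rewrite (path_sum_start _ _ _ t0)// (path_sum_end _ _ _ t0)//.
rewrite (path_sum_embed e_inj) => [|k [j]].
  apply: eq_bigr => k _; rewrite !e0 ?eqxx ?orbT// mul1r mulr1.
  by apply: eq_bigr => m _; rewrite /c' /end_core /start_core.
rewrite eP /S'; have [->|j0]/= := eqVneq j ord0.
  by rewrite inE => /negbTE ->; rewrite !mul0r.
have [->|jM]/= := eqVneq j ord_max.
  by rewrite inE => /negbTE ->; rewrite !mulr0.
have [m jE] := rposP j0; rewrite jE => kS.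
rewrite (bigD1 m)//= /end_core ifF; last first.
  apply: contraNF jM => /eqP mM.
  by rewrite jE -(inj_eq val_inj)/= /bump/= add1n mM.
have -> : start_core a (fun m => c m (mu m)) m (k (lpos m)) (k (rpos m)) = 0.
  rewrite /start_core; case: ifP => _; last by rewrite cS.
  by rewrite big1 // => u _; rewrite cS// mulr0.
by rewrite mul0r mulr0 mul0r.
Qed.

End path_sums.

(** * Gaussian integrals of products of polynomials *)

Lemma integrable_prodM d1 d2 (T1 : measurableType d1) (T2 : measurableType d2)
    (R : realType) (m1 : {sigma_finite_measure set T1 -> \bar R})
    (m2 : {sigma_finite_measure set T2 -> \bar R}) (f : T1 -> R) (g : T2 -> R) :
  m1.-integrable setT (EFin \o f) -> m2.-integrable setT (EFin \o g) ->
  (m1 \x m2)%E.-integrable setT (fun z => (f z.1 * g z.2)%:E) /\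
  (\int[m1 \x m2]_z (f z.1 * g z.2)%:E =
   \int[m1]_x (f x)%:E * \int[m2]_y (g y)%:E)%E.
Proof.
move=> fi gi; have /integrableP[/measurable_EFinP mf foo] := fi.
have /integrableP[/measurable_EFinP mg goo] := gi.
have fgi : (m1 \x m2)%E.-integrable setT (fun z => (f z.1 * g z.2)%:E).
  apply/integrable12ltyP.
    apply/measurable_EFinP; apply: measurable_funM.
      by apply: measurableT_comp.
    by apply: measurableT_comp.
  have gfin : (\int[m2]_y `|(g y)%:E| \is a fin_num)%E.
    by rewrite ge0_fin_numE// integral_ge0.
  rewrite (eq_integral (fun x => `|(f x)%:E| * \int[m2]_y `|(g y)%:E|)%E)//=.
    rewrite -(fineK gfin) ge0_integralZr//; last 2 first.
    - by do 2 apply: measurableT_comp => //.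
    - by rewrite lee_fin fine_ge0// integral_ge0.
    by rewrite lte_mul_pinfty ?ltry ?integral_ge0//;
      rewrite ge0_fin_numE ?integral_ge0.
  move=> x _; rewrite -ge0_integralZl//; last first.
    by do 2 apply: measurableT_comp => //.
  by apply: eq_integral => y _; rewrite /= normrM.
split => //; rewrite -integral12_prod_meas1// /fubini_F/=.
rewrite (eq_integral (fun x => (f x)%:E * \int[m2]_y (g y)%:E)%E)//=.
  by rewrite -(fineK (integrable_fin_num _ gi))// integralZr.
by move=> x _; rewrite -integralZl.
Qed.

Section integrals.
Context {R : realType}.
Local Notation RT := (measurableTypeR R).
Local Notation leb := (@lebesgue_measure R).

(** The measure on (n+1)-tuples is the image of a product measure under
    [cons_pair], so that Fubini splits off one coordinate at a time. *)
Lemma lebesgue_tuple_prod n (f : 'I_n -> R -> R) :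
  (forall m, leb.-integrable setT (EFin \o f m)) ->
  (lebesgue_tuple n).-integrable setT
    (fun t : n.-tuple RT => (\prod_(m < n) f m (tnth t m))%:E) /\
  (\int[lebesgue_tuple n]_t (\prod_(m < n) f m (tnth t m))%:E =
   (\prod_(m < n) \int[leb]_x f m x)%:E)%E.
Proof.
elim: n f => [|n IHn] f f_int.
  have E : (fun t : 0.-tuple RT => (\prod_(m < 0) f m (tnth t m))%:E) = cst 1%E.
    by apply/funext => t; rewrite big_ord0.
  rewrite E big_ord0; split; last first.
    by rewrite integral_cst//= diracE mem_set//= mule1.
  apply/integrableP; split; first exact: measurable_cst.
  by rewrite integral_cst//= diracE mem_set//= normr1 mule1 ltry.
have [int_t Et] := IHn (fun m => f (lift ord0 m)) (fun m => f_int _).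
set F := fun t : n.+1.-tuple RT => _.
pose G (z : RT * n.-tuple RT) :=
  (f ord0 z.1 * \prod_(m < n) f (lift ord0 m) (tnth z.2 m))%:E.
have FG : F \o @cons_pair R n = G.
  apply/funext => -[x t]; rewrite /F /G /= big_ord_recl/=; congr (_ * _)%:E.
  by apply: eq_bigr => m _; rewrite tnthS.
have mf m : measurable_fun setT (f m : RT -> R).
  by have /integrableP[/measurable_EFinP] := f_int m.
have mF : measurable_fun setT F.
  apply/measurable_EFinP; apply: measurable_prod => m _.
  by apply: measurableT_comp => //; exact: measurable_tnth.
have [G_int GE] := @integrable_prodM _ _ _ _ R leb (lebesgue_tuple n) _ _
  (f_int ord0) int_t.
split.
- apply: (@integrable_pushforward _ _ _ _ R _ (@measurable_cons_pair R n)
   (leb \x lebesgue_tuple n)%E setT F) => //.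
  by rewrite FG.
- transitivity (\int[(leb \x lebesgue_tuple n)]_z G z)%E.
    rewrite -FG; apply: (@integral_pushforward _ _ _ _ R _
     (@measurable_cons_pair R n) (leb \x lebesgue_tuple n)%E setT F) => //.
    by rewrite FG.
  rewrite GE Et big_ord_recl EFinM; congr (_ * _)%E.
  by rewrite /Rintegral fineK// integrable_fin_num//; exact: f_int.
Qed.
End integrals.

Section polynomials.
Context {R : realType} (p : nat -> {poly R}).
Hypothesis p_basis : orthonormal_poly_basis p.
Local Notation RT := (measurableTypeR R).
Local Notation leb := (@lebesgue_measure R).

Definition gauss_mean (q : {poly R}) : R := \int[leb]_x (q.[x] * rho x).

Lemma rho_ge0 x : 0 <= rho x :> R.
Proof. exact: normal_pdf_ge0. Qed.

Lemma measurable_poly_rho (q : {poly R}) :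
  measurable_fun setT (fun x : RT => (q.[x] * rho x)%:E).
Proof.
apply/measurable_EFinP; apply: measurable_funM.
  exact: measurable_poly.
exact: measurable_normal_pdf.
Qed.

(** The squares are integrable because a non-integrable nonnegative function has
    integral [+oo], which [fine] sends to 0 and not to 1; the products are
    dominated by sums of squares. *)
Lemma integrable_basisM i j :
  leb.-integrable setT (fun x => ((p i * p j).[x] * rho x)%:E).
Proof.
have [_ ortho _] := p_basis.
have sq k : leb.-integrable setT (fun x => ((p k * p k).[x] * rho x)%:E).
  apply/integrableP; split; first exact: measurable_poly_rho.
  rewrite (eq_integral (fun x : RT => ((p k).[x] * (p k).[x] * rho x)%:E)); last first.
    move=> x _; rewrite /= hornerM ger0_norm// mulr_ge0 ?rho_ge0//.
    by rewrite -expr2 sqr_ge0.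
  have := ortho k k; rewrite eqxx /Rintegral.
  set I := (\int[_]_(_ in _) _)%E; case: I => [s _| /=|//]; first by rewrite ltry.
  by move=> /esym/eqP; rewrite oner_eq0.
apply: (@le_integrable _ _ _ _ _ measurableT _
  (fun x : RT => ((p i * p i).[x] * rho x)%:E + ((p j * p j).[x] * rho x)%:E)%E).
- exact: measurable_poly_rho.
- move=> x _; rewrite /= lee_fin !hornerM -mulrDl !normrM.
  rewrite (ger0_norm (rho_ge0 x)) ler_wpM2r ?rho_ge0//.
  set u := (p i).[x]; set v := (p j).[x].
  rewrite (@ger0_norm _ (u * u + _)); last by rewrite -!expr2 addr_ge0 ?sqr_ge0.
  have sq_norm w : w * w = `|w| * `|w| :> R.
    by rewrite -normrM ger0_norm// -expr2 sqr_ge0.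
  rewrite (sq_norm u) (sq_norm v).
  have := normr_ge0 u; have := normr_ge0 v; move: `|u| `|v| => a b; nra.
- exact: integrableD.
Qed.

(** By induction on the degree: subtracting a multiple of [p k] removes the
    leading term, and [p k] is itself a multiple of [p k * p 0], since [p 0] is a
    nonzero constant. *)
Lemma integrable_poly_rho (q : {poly R}) :
  leb.-integrable setT (fun x => (q.[x] * rho x)%:E).
Proof.
have [size_p _ _] := p_basis.
have /eqP/size_poly1P[c0 c0_neq0 p0E] := size_p 0%N.
have [n] := ubnP (size q); elim: n q => // n IHn q.
have [->|q0] := eqVneq q 0.
  move=> _; rewrite (_ : (fun x => _) = cst 0%E); first exact: integrable0.
  by apply/funext => x; rewrite horner0 mul0r.
rewrite ltnS => qn; pose k := (size q).-1.
pose c := lead_coef q / lead_coef (p k).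
have sq : size q = k.+1 by rewrite /k prednK// size_poly_gt0.
have lp : lead_coef (p k) != 0 by rewrite lead_coef_eq0 -size_poly_eq0 size_p.
have sz : (size (q - c *: p k)%R < n)%N.
  apply: leq_trans qn; rewrite sq ltnS; apply/leq_sizeP => j.
  rewrite leq_eqVlt coefB coefZ => /orP[/eqP <-|kj].
    have -> : (p k)`_k = lead_coef (p k) by rewrite lead_coefE size_p.
    by rewrite /c divfK// lead_coefE -/k subrr.
  by rewrite !nth_default ?mulr0 ?subrr// ?size_p ?sq.
rewrite (_ : (fun x => _) = (fun x => ((q - c *: p k).[x] * rho x)%:E +
    (c / c0)%:E * ((p k * p 0).[x] * rho x)%:E)%E).
  apply: integrableD => //; first exact: IHn.
  by apply: integrableZl => //; exact: integrable_basisM.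
apply/funext => x; rewrite -EFinM -EFinD hornerD hornerN hornerZ hornerM p0E.
by rewrite hornerC; congr EFin; field.
Qed.

(** Integrability is kept together with the value, for the inner product to be
    additive in [f]. *)
Definition inner_spec M (g f : 'rV[R]_M -> R) (v : R) :=
  (lebesgue_tuple M).-integrable setT
    (fun t => let y := point_of_tuple t in (f y * g y * varrho y)%:E) /\
  innerL2 f g = v.

Lemma inner_spec_prod M (q q' : 'I_M -> {poly R}) :
  inner_spec (fun y => \prod_m (q' m).[y 0 m]) (fun y => \prod_m (q m).[y 0 m])
    (\prod_m gauss_mean (q m * q' m)).
Proof.
have E (t : M.-tuple RT) : let y := point_of_tuple t in
    \prod_m (q m).[y 0 m] * \prod_m (q' m).[y 0 m] * varrho y =
    \prod_m ((q m * q' m).[tnth t m] * rho (tnth t m)).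
  rewrite /= -!big_split/=; apply: eq_bigr => m _.
  by rewrite hornerM !mxE.
have [int_t Et] := lebesgue_tuple_prod (fun m => integrable_poly_rho (q m * q' m)).
split; first by apply: eq_integrable int_t => // t _; rewrite /= E.
rewrite /innerL2 /Rintegral.
by rewrite (eq_integral _ _ (fun t _ => congr1 EFin (E t))) Et.
Qed.

Lemma inner_specD M (g f f' : 'rV[R]_M -> R) v v' :
  inner_spec g f v -> inner_spec g f' v' ->
  inner_spec g (fun y => f y + f' y) (v + v').
Proof.
move=> [fi <-] [fi' <-]; split.
  rewrite (_ : (fun t => _) = (fun t => let y := point_of_tuple t in
    (f y * g y * varrho y)%:E + (f' y * g y * varrho y)%:E)%E).
    exact: integrableD.
  by apply/funext => t /=; rewrite -EFinD !mulrDl.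
rewrite /innerL2 -RintegralD//.
by apply: eq_Rintegral => t _ /=; rewrite !mulrDl.
Qed.

Lemma inner_specZ M (g f : 'rV[R]_M -> R) v c :
  inner_spec g f v -> inner_spec g (fun y => c * f y) (c * v).
Proof.
move=> [fi <-]; split.
  rewrite (_ : (fun t => _) = (fun t => let y := point_of_tuple t in
    c%:E * (f y * g y * varrho y)%:E)%E).
    exact: integrableZl.
  by apply/funext => t /=; rewrite -EFinM !mulrA.
rewrite /innerL2 -RintegralZl//.
by apply: eq_Rintegral => t _ /=; rewrite !mulrA.
Qed.

Lemma inner_spec0 M (g : 'rV[R]_M -> R) : inner_spec g (fun=> 0) 0.
Proof.
have E (t : M.-tuple RT) : let y := point_of_tuple t in
    0 * g y * varrho y = 0 by rewrite /= !mul0r.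
split; first by apply: eq_integrable (integrable0 _ _) => // t _; rewrite /= E.
rewrite /innerL2 /Rintegral (eq_integral _ _ (fun t _ => congr1 EFin (E t))).
by rewrite integral0.
Qed.

Lemma inner_spec_sum M (g : 'rV[R]_M -> R) (I : finType)
    (f : I -> 'rV[R]_M -> R) v :
  (forall i, inner_spec g (f i) (v i)) ->
  inner_spec g (fun y => \sum_i f i y) (\sum_i v i).
Proof.
move=> fv; elim: (index_enum I) => [|i s IHs].
  rewrite big_nil (_ : (fun y => _) = fun=> 0); first exact: inner_spec0.
  by apply/funext => y; rewrite big_nil.
rewrite big_cons; rewrite (_ : (fun y => _) =
  fun y => f i y + \sum_(j <- s) f j y); first exact: inner_specD.
by apply/funext => y; rewrite big_cons.
Qed.

(** * Partial derivatives of product expansions *)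

(** Both derivatives are limits of the same difference quotients. *)
Lemma partial_line M (m : 'I_M) (f : 'rV[R]_M -> R) (q : {poly R}) y :
  (forall t, f (t *: delta_mx 0 m + y) = q.[t + y 0 m]) ->
  partial m f y = q^`().[y 0 m].
Proof.
move=> fq; rewrite derivE derive1E /partial /derive.
have fy : f y = q.[y 0 m] by have := fq 0; rewrite scale0r !add0r.
have E : (fun t : R => t^-1 *: ((f \o shift y) (t *: 'e_m) - f y)) =
    (fun t : R => t^-1 *: ((horner q \o shift (y 0 m)) t%:A - q.[y 0 m])).
  by apply/funext => t /=; rewrite fq fy [t%:A]mulr1.
by rewrite E.
Qed.

Definition deriv_if (b : bool) (q : {poly R}) := if b then q^`() else q.

(** As a function of the m-th coordinate alone, the sum is one polynomial. *)
Lemma partial_sum_prod M (m : 'I_M) (I : finType) (w : I -> R)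
    (q : I -> 'I_M -> {poly R}) y :
  partial m (fun y => \sum_i w i * \prod_l (q i l).[y 0 l]) y =
  \sum_i w i * \prod_l (deriv_if (l == m) (q i l)).[y 0 l].
Proof.
pose Q := \sum_i (w i * \prod_(l | l != m) (q i l).[y 0 l]) *: q i m.
rewrite (@partial_line _ _ _ Q); last first.
  move=> t; rewrite horner_sum; apply: eq_bigr => i _.
  rewrite hornerZ -mulrA; congr (_ * _).
  rewrite (bigD1 m)//= !mxE !eqxx mulr1 mulrC; congr (_ * _).
  by apply: eq_bigr => l lm; rewrite !mxE (negbTE lm) andbF mulr0 add0r.
rewrite linear_sum horner_sum; apply: eq_bigr => i _ /=.
rewrite derivZ hornerZ -mulrA; congr (_ * _).
rewrite [RHS](bigD1 m)//= eqxx mulrC; congr (_ * _).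
by apply: eq_bigr => l lm; rewrite (negbTE lm).
Qed.

Lemma partial_expansion M (m : 'I_M) d (w : tensor R M d) y :
  partial m (expansion p w) y =
  \sum_mu w mu * \prod_l (deriv_if (l == m) (p (mu l))).[y 0 l].
Proof. exact: (partial_sum_prod m w (fun mu l => p (mu l))). Qed.

Lemma partial_Pprod M (m : 'I_M) d (nu : midx M d) y :
  partial m (Pprod p nu) y = \prod_l (deriv_if (l == m) (p (nu l))).[y 0 l].
Proof.
have -> : Pprod p nu = fun y : 'rV[R]_M =>
    \sum_(i < 1) 1 * \prod_l (p (nu l)).[y 0 l].
  by apply/funext => z; rewrite big_ord1 mul1r.
rewrite (partial_sum_prod m (fun=> 1) (fun=> fun l => p (nu l))).
by rewrite big_ord1 mul1r.
Qed.

(** * The system as sums over paths *)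

Lemma Bop_gauss_mean M da dt dh (h : tensor R M dh) m (ka : midx M dt)
    (nu : midx M da) :
  Bop p h m ka nu =
  \prod_l gauss_mean (deriv_if (l == m) (p (nu l)) * p (ka l)) -
  \sum_la h la *
    \prod_l gauss_mean (p (nu l) * deriv_if (l == m) (p (la l)) * p (ka l)).
Proof.
rewrite /Bop.
have -> : (fun y => partial m (Pprod p nu) y -
                    Pprod p nu y * partial m (expansion p h) y) =
  fun y => \prod_l (deriv_if (l == m) (p (nu l))).[y 0 l] + (-1) *
    \sum_la h la * \prod_l (p (nu l) * deriv_if (l == m) (p (la l))).[y 0 l].
  apply/funext => y; rewrite partial_Pprod partial_expansion mulN1r.
  congr (_ - _); rewrite mulr_sumr; apply: eq_bigr => la _.
  rewrite mulrCA -big_split/=; congr (_ * _).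
  by apply: eq_bigr => l _; rewrite hornerM.
have D := inner_spec_prod (fun l => deriv_if (l == m) (p (nu l))) (fun l => p (ka l)).
have C := inner_spec_sum (fun la => inner_specZ (h la) (inner_spec_prod
  (fun l => p (nu l) * deriv_if (l == m) (p (la l))) (fun l => p (ka l)))).
rewrite -[X in _ = _ + X]mulN1r; exact: (inner_specD D (inner_specZ (-1) C)).2.
Qed.

Lemma fvec_gauss_mean M dt dh (h : tensor R M dh) m (ka : midx M dt) :
  fvec p h m ka = expR (expansion p h 0) *
    \sum_la h la * \prod_l gauss_mean (deriv_if (l == m) (p (la l)) * p (ka l)).
Proof.
rewrite /fvec.
have -> : (fun y => expR (expansion p h 0) * partial m (expansion p h) y) =
  fun y => expR (expansion p h 0) *
    \sum_la h la * \prod_l (deriv_if (l == m) (p (la l))).[y 0 l].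
  by apply/funext => y; rewrite partial_expansion.
have C := inner_spec_sum (fun la => inner_specZ (h la) (inner_spec_prod
  (fun l => deriv_if (l == m) (p (la l))) (fun l => p (ka l)))).
exact: (inner_specZ _ C).2.
Qed.

End polynomials.

Lemma untag_Tagged (I : eqType) (T_ : I -> Type) (A : Type) (idx : A) (i : I)
    (F : T_ i -> A) (x : T_ i) : untag idx F (Tagged T_ x) = F x.
Proof. exact: (untagE idx F (erefl i : tag (Tagged T_ x) = i)). Qed.

(** Contracting a tensor train with a rank one tensor [Z] gives a path sum whose
    m-th core only sees the m-th factor of [Z].  The common state space is the
    disjoint union of the index sets of all bonds, and the cores are extended by
    zero. *)
Lemma tt_contraction (R : realType) M d (r : 'I_M.+1 -> nat) (w : tensor R M d) :
  has_tt r w ->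
  exists (T : finType) (t0 : T) (S : 'I_M.+1 -> pred T) (a : T -> R)
    (G : 'I_M -> 'I_d -> T -> T -> R),
  [/\ forall j, #|S j| = r j,
      forall m i x y, y \notin S (rpos m) -> G m i x y = 0
    & forall Z : 'I_M -> 'I_d -> R,
        \sum_(mu : midx M d) w mu * \prod_m Z m (mu m) =
        path_sum a (fun=> 1) (fun m x y => \sum_i G m i x y * Z m i)].
Proof.
move=> [r0 _ [core wE]].
pose T : finType := {j : 'I_M.+1 & 'I_(r j)}.
pose e j (x : 'I_(r j)) : T := Tagged (fun j => 'I_(r j)) x.
have e_inj j : injective (e j) by move=> x y /eqP; rewrite eq_Tagged => /eqP.
have eE j u : (u \in codom (e j)) = (tag u == j).
  apply/codomP/eqP => [[x ->]//|]; case: u => i x /= ij.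
  by move: x; rewrite ij => x; exists x.
pose G m i (u v : T) : R :=
  @untag _ (fun j => 'I_(r j)) _ 0 _ (fun x =>
    @untag _ (fun j => 'I_(r j)) _ 0 _ (fun y => core m x i y) v) u.
exists T, (e ord0 (cast_ord (esym r0) ord0)), (fun j => [pred u | tag u == j]).
exists (fun u => (tag u == ord0)%:R), G; split.
- move=> j; rewrite -[RHS]card_ord -(card_codom (e_inj j)).
  by apply: eq_card => u; rewrite eE.
- move=> m i x y; rewrite inE => ym; rewrite /G /untag; case: eqP => // xm.
  exact: untag_dflt.
- move=> Z; rewrite (path_sum_embed e_inj) => [|k [j]]; last first.
    rewrite eE; have [->|j0] := eqVneq j ord0.
      by move=> /negbTE ->; rewrite !mul0r.
    have [m ->] := rposP j0 => km.
    rewrite (bigD1 m)//= big1 ?mul0r ?mulr0 ?mul0r// => i _.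
    rewrite /G [X in X * _](_ : _ = 0) ?mul0r// /untag; case: eqP => // xm.
    exact: untag_dflt.
  transitivity (\sum_(mu : midx M d) \sum_(k : {dffun forall j, 'I_(r j)})
     \prod_m (core m (k (lpos m)) (mu m) (k (rpos m)) * Z m (mu m))).
    apply: eq_bigr => mu _; rewrite wE mulr_suml.
    by apply: eq_bigr => k _; rewrite big_split.
  rewrite exchange_big; apply: eq_bigr => k _ /=.
  rewrite -(bigA_distr_bigA (fun m i =>
    core m (k (lpos m)) i (k (rpos m)) * Z m i)).
  rewrite mul1r mulr1; apply: eq_bigr => m _; apply: eq_bigr => i _.
  by rewrite /G /e !untag_Tagged.
Qed.

Definition option_pred (T : Type) (P : pred T) : pred (option T) := oapp P true.

Lemma card_option_pred (T : finType) (P : pred T) :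
  #|option_pred P| = #|P|.+1.
Proof.
rewrite (cardD1 None) add1n; congr _.+1.
rewrite -(fintype.card_image Some_inj); apply: eq_card => -[x|]; rewrite !inE/=.
  by rewrite (fintype.mem_image Some_inj).
by apply/esym/fintype.imageP => -[].
Qed.

Section assembly.
Context {R : realType} (p : nat -> {poly R}).
Hypothesis p_basis : orthonormal_poly_basis p.
Context {M da dt dh : nat} (h : tensor R M dh).
Context {T : finType} (S : 'I_M.+1 -> pred T) (a : T -> R).
Context (G : 'I_M -> 'I_dh -> T -> T -> R).
Hypothesis G_supp : forall m i x y, y \notin S (rpos m) -> G m i x y = 0.
Hypothesis contractE : forall Z : 'I_M -> 'I_dh -> R,
  \sum_(mu : midx M dh) h mu * \prod_m Z m (mu m) =
  path_sum a (fun=> 1) (fun m x y => \sum_i G m i x y * Z m i).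

(** The bit [b] tells whether the position is the differentiated one; the state
    [None] carries the term [partial m (Pprod nu)] and the states [Some x] carry
    [Pprod nu * partial m h]. *)
Definition Bcore (b : bool) (nu : 'I_da) (ka : 'I_dt) :
    'I_M -> option T -> option T -> R :=
  option_core (fun=> gauss_mean (deriv_if b (p nu) * p ka))
    (fun m x y => \sum_i G m i x y *
       gauss_mean (p nu * deriv_if b (p i) * p ka)).

Definition fcore (b : bool) (ka : 'I_dt) (m : 'I_M) (x y : T) : R :=
  \sum_i G m i x y * gauss_mean (deriv_if b (p i) * p ka).

(** The minus sign is put in the start weight, so that the cores depend on [m]
    only through the comparison of the position with [m]. *)
Lemma Bop_path_sum m (ka : midx M dt) (nu : midx M da) :
  Bop p h m ka nu =
  path_sum (oapp (fun x => - a x) 1) (oapp (fun=> 1) 1)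
    (fun l => Bcore (l == m) (nu l) (ka l) l).
Proof.
rewrite Bop_gauss_mean// (contractE (fun l i =>
  gauss_mean (p (nu l) * deriv_if (l == m) (p i) * p (ka l)))).
transitivity (path_sum (oapp (fun x => - a x) 1) (oapp (fun=> 1) 1) (option_core
  (fun l => gauss_mean (deriv_if (l == m) (p (nu l)) * p (ka l)))
  (fun l x y => \sum_i G l i x y *
     gauss_mean (p (nu l) * deriv_if (l == m) (p i) * p (ka l))))).
  rewrite path_sum_option mul1r mulr1; congr (_ + _).
  by rewrite /path_sum -sumrN; apply: eq_bigr => k _; rewrite !mulNr.
by apply: eq_path_sum => l [x|] [y|].
Qed.

Lemma fvec_path_sum m (ka : midx M dt) :
  fvec p h m ka =
  path_sum (fun x => expR (expansion p h 0) * a x) (fun=> 1)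
    (fun l => fcore (l == m) (ka l) l).
Proof.
rewrite fvec_gauss_mean// (contractE (fun l i =>
  gauss_mean (deriv_if (l == m) (p i) * p (ka l)))).
by rewrite /path_sum mulr_sumr; apply: eq_bigr => k _; rewrite !mulrA.
Qed.

Definition BBcore (b : bool) (mn : 'I_da * 'I_da) (m : 'I_M)
    (x y : option T * option T) : R :=
  \sum_(ka < dt) pair_core (Bcore b mn.1 ka) (Bcore b mn.2 ka) m x y.

Definition Bfcore (b : bool) (nu : 'I_da) (m : 'I_M)
    (x y : option T * T) : R :=
  \sum_(ka < dt) pair_core (Bcore b nu ka) (fcore b ka) m x y.

Definition Wcore (m : 'I_M) (mn : 'I_da * 'I_da) :
    option (bool * (option T * option T)) ->
    option (bool * (option T * option T)) -> R :=
  option_core (fun=> (p mn.1).[0] * (p mn.2).[0])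
    (step_core (BBcore false mn) (BBcore true mn)) m.

Definition bcore (m : 'I_M) (nu : 'I_da) : bool * (option T * T) ->
    bool * (option T * T) -> R :=
  step_core (Bfcore false nu) (Bfcore true nu) m.

Lemma Wop_path_sum : exists A B, forall mu nu : midx M da,
  Wop p da dt h mu nu = path_sum A B (fun m => Wcore m (mu m, nu m)).
Proof.
pose A := oapp (fun x : T => - a x) 1; pose B := oapp (fun _ : T => 1 : R) 1.
pose AA x : R := A x.1 * A x.2; pose BB x : R := B x.1 * B x.2.
exists (oapp (fun x : bool * _ => if x.1 then 0 else AA x.2) 1).
exists (oapp (fun x : bool * _ => if x.1 then BB x.2 else 0) 1) => mu nu.
transitivity (path_sum (oapp (fun x : bool * _ => if x.1 then 0 else AA x.2) 1)
    (oapp (fun x : bool * _ => if x.1 then BB x.2 else 0) 1)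
  (option_core (fun m => (p (mu m)).[0] * (p (nu m)).[0])
    (step_core (fun m => BBcore false (mu m, nu m) m)
               (fun m => BBcore true (mu m, nu m) m)))); last first.
  by apply: eq_path_sum => m [[[] x]|] [[[] y]|].
rewrite path_sum_option mul1r mulr1 path_sum_step; congr (_ + _).
  rewrite /Pvec /Pprod -big_split/=; apply: eq_bigr => m _.
  by rewrite !mxE.
apply: eq_bigr => m _.
transitivity (path_sum AA BB (fun l => BBcore (l == m) (mu l, nu l) l)); last first.
  by apply: eq_path_sum => l x y; case: eqP.
rewrite /BBcore -(sum_path_sum _ _ (fun l ka =>
  pair_core (Bcore (l == m) (mu l) ka) (Bcore (l == m) (nu l) ka) l)).
apply: eq_bigr => ka _; rewrite !Bop_path_sum -path_sum_pair.
exact: eq_path_sum.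
Qed.

Lemma bvec_path_sum : exists A B, forall nu : midx M da,
  bvec p da dt h nu = path_sum A B (fun m => bcore m (nu m)).
Proof.
pose A := oapp (fun x : T => - a x) 1; pose B := oapp (fun _ : T => 1 : R) 1.
pose AA x : R := A x.1 * (expR (expansion p h 0) * a x.2).
pose BB (x : option T * T) : R := B x.1 * 1.
exists (fun x => if x.1 then 0 else AA x.2).
exists (fun x => if x.1 then BB x.2 else 0) => nu.
transitivity (path_sum (fun x : bool * _ => if x.1 then 0 else AA x.2)
    (fun x : bool * _ => if x.1 then BB x.2 else 0)
  (step_core (fun m => Bfcore false (nu m) m)
             (fun m => Bfcore true (nu m) m))); last first.
  by apply: eq_path_sum => m [[] x] [[] y].
rewrite path_sum_step; apply: eq_bigr => m _.
transitivity (path_sum AA BB (fun l => Bfcore (l == m) (nu l) l)); last first.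
  by apply: eq_path_sum => l x y; case: eqP.
rewrite /Bfcore -(sum_path_sum _ _ (fun l ka =>
  pair_core (Bcore (l == m) (nu l) ka) (fcore (l == m) ka) l)).
apply: eq_bigr => ka _; rewrite Bop_path_sum fvec_path_sum -path_sum_pair.
exact: eq_path_sum.
Qed.

(** * Ranks *)

Definition Wsupp (j : 'I_M.+1) : pred (option (bool * (option T * option T))) :=
  option_pred
    [predX predT & [predX option_pred (S j) & option_pred (S j)]].

Definition bsupp (j : 'I_M.+1) : pred (bool * (option T * T)) :=
  [predX predT & [predX option_pred (S j) & S j]].

Lemma Bcore_supp b nu ka m x y :
  y \notin option_pred (S (rpos m)) -> Bcore b nu ka m x y = 0.
Proof.
case: y => [y|]//=; case: x => [x|]//= yS; rewrite /Bcore /= big1// => i _.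
by rewrite G_supp ?mul0r.
Qed.

Lemma fcore_supp b ka m x y : y \notin S (rpos m) -> fcore b ka m x y = 0.
Proof. by move=> yS; rewrite /fcore big1// => i _; rewrite G_supp ?mul0r. Qed.

Lemma BBcore_supp b mn m x y :
  y \notin [predX option_pred (S (rpos m)) & option_pred (S (rpos m))] ->
  BBcore b mn m x y = 0.
Proof.
rewrite inE/= negb_and => yS; rewrite /BBcore big1// => ka _; rewrite /pair_core.
by case/orP: yS => yS; rewrite (Bcore_supp _ _ _ _ yS) ?mul0r ?mulr0.
Qed.

Lemma Bfcore_supp b nu m x y :
  y \notin [predX option_pred (S (rpos m)) & S (rpos m)] ->
  Bfcore b nu m x y = 0.
Proof.
rewrite inE/= negb_and => yS; rewrite /Bfcore big1// => ka _; rewrite /pair_core.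
case/orP: yS => yS; first by rewrite (Bcore_supp _ _ _ _ yS) mul0r.
by rewrite (fcore_supp _ _ _ yS) mulr0.
Qed.

Lemma Wcore_supp m mn x y : y \notin Wsupp (rpos m) -> Wcore m mn x y = 0.
Proof.
case: y => [[c y]|]//; case: x => [[b x]|]// yS; rewrite /Wcore/= /step_core.
by case: b; case: c yS => yS //=; rewrite BBcore_supp.
Qed.

Lemma bcore_supp m nu x y : y \notin bsupp (rpos m) -> bcore m nu x y = 0.
Proof.
case: y => [c y]; case: x => [b x] yS; rewrite /bcore/= /step_core.
by case: b; case: c yS => yS //=; rewrite Bfcore_supp.
Qed.

Lemma card_Wsupp j : #|Wsupp j| = (2 * (#|S j| + 1) ^ 2 + 1)%N.
Proof. by rewrite card_option_pred !cardX card_bool card_option_pred !addn1. Qed.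

Lemma card_bsupp j : #|bsupp j| = (2 * #|S j| * (#|S j| + 1))%N.
Proof.
by rewrite !cardX card_bool card_option_pred addn1 -mulnA [X in (2 * X)%N]mulnC.
Qed.

End assembly.

Theorem mainTheorem3 (R : realType) (p : nat -> {poly R})
    (hp : orthonormal_poly_basis p)
    (M da dt dh : nat) (hM : (2 <= M)%N)
    (hda : (0 < da)%N) (hdt : (0 < dt)%N) (hdh : (0 < dh)%N)
    (hd : (da + dh - 1 <= dt)%N)
    (h : tensor R M dh) (r : 'I_M.+1 -> nat) (hr : has_tt r h) :
  has_tt_op (inner_ranks (fun rj => 2 * (rj + 1) ^ 2 + 1)%N r) (Wop p da dt h)
  /\ has_tt (inner_ranks (fun rj => 2 * rj * (rj + 1))%N r) (bvec p da dt h).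
Proof.
have [T [t0 [S [a [G [rS G_supp contractE]]]]]] := tt_contraction hr.
have M0 : (0 < M)%N := ltnW hM.
have r0 s : inner_ranks s r ord0 = 1%N by rewrite /inner_ranks eqxx.
have rM s : inner_ranks s r ord_max = 1%N by rewrite /inner_ranks eqxx orbT.
have rI s j : j != ord0 -> j != ord_max -> inner_ranks s r j = s (r j).
  by move=> /negbTE j0 /negbTE jM; rewrite /inner_ranks j0 jM.
split; split => //.
- have [A [B WE]] := Wop_path_sum hp (da := da) (dt := dt) contractE.
  have rW j : j != ord0 -> j != ord_max -> #|Wsupp S j| =
      inner_ranks (fun rj => 2 * (rj + 1) ^ 2 + 1)%N r j.
    by move=> j0 jM; rewrite card_Wsupp rS rI.
  have [core coreE] := path_sum_tt None A B M0 (r0 _) (rM _) rW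
    (Wcore_supp p (da := da) (dt := dt) G_supp).
  exists (fun m x i k y => core m x (i, k) y) => mu nu.
  by rewrite WE (coreE (fun m => (mu m, nu m))).
- have [A [B bE]] := bvec_path_sum hp (da := da) (dt := dt) contractE.
  have rb j : j != ord0 -> j != ord_max -> #|bsupp S j| =
      inner_ranks (fun rj => 2 * rj * (rj + 1))%N r j.
    by move=> j0 jM; rewrite card_bsupp rS rI.
  have [core coreE] := path_sum_tt (false, (None, t0)) A B M0 (r0 _) (rM _) rb
    (bcore_supp p (da := da) (dt := dt) G_supp).
  by exists core => nu; rewrite bE coreE.
Qed.
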